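(* There is an absolute constant $C$ such that every degree 3-critical graph on $n$ vertices contains cycles of at least $\frac{\log_2 n}{3+\log_2 3}-C$ distinct lengths.
   Context: A graph with $n$ vertices is degree 3-critical if it has exactly $2n-2$ edges and no proper induced subgraph has minimum degree at least $3$. The length of a cycle is its number of edges. *)

(* Defs.v *)
From mathcomp Require Import all_boot.

Set Implicit Arguments.
Unset Strict Implicit.
Unset Printing Implicit Defensive.

Record sgraph := SGraph {
  vertex :> finType;
  adj : rel vertex;
  adj_sym : symmetric adj;
  adj_irrefl : irreflexive adj }.

Definition edges (G : sgraph) : {set {set G}} :=
  [set A : {set G} | [exists x, exists y, adj x y && (A == [set x; y])]].

Definition degree (G : sgraph) (x : G) : nat := #|[set y : G | adj x y]|.

Section Induced.
Variables (G : sgraph) (S : {set G}).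

Definition induced_adj : rel {x : G | x \in S} :=
  fun x y => adj (val x) (val y).

Fact induced_sym : symmetric induced_adj.
Proof. by move=> x y; apply: adj_sym. Qed.

Fact induced_irrefl : irreflexive induced_adj.
Proof. by move=> x; apply: adj_irrefl. Qed.

Definition induced : sgraph := SGraph induced_sym induced_irrefl.

End Induced.

Definition min_degree_geq (G : sgraph) (k : nat) : bool :=
  [forall x : G, k <= degree x].

(* Only nonempty S are considered, as [min_degree_geq] is vacuous on the empty
   graph.  The edge count is written without truncated subtraction, under which
   the graph with no vertices would have 2 * 0 - 2 = 0 edges. *)
Definition degree3_critical (G : sgraph) : Prop :=
  #|edges G| + 2 = 2 * #|G| /\
  forall S : {set G}, S != set0 -> S \proper [set: G] ->
    ~~ min_degree_geq (induced S) 3.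

(* A cycle of length k is given by its k >= 3 distinct vertices in cyclic order;
   hence k <= #|G|, and 'I_(#|G|.+1) contains every cycle length. *)
Definition cycle_lengths (G : sgraph) : {set 'I_(#|G|.+1)} :=
  [set k : 'I_(#|G|.+1) |
    (2 < k) && [exists c : k.-tuple G, ucycleb (@adj G) c]].

From mathcomp Require Import all_algebra reals exp.

Definition log2 (R : realType) (x : R) : R := (ln x / ln 2)%R.

(* Main.v *)
(* Deleting a vertex of degree 3 and then repeatedly a vertex of degree 2
   orients a critical graph G acyclically, with all out-degrees at most 3, every
   out-degree at least 2 except at the last two vertices, and a unique source.
   Let h be the length of a longest directed path from a vertex, dep the length
   of a longest directed path to it, and k the number of cycle lengths.

   A vertex z with h z = j > 1 is the top of a cycle of length between j + 1 and
   2 j + 1, so k is at least about log2 of the largest value of h (and of dep).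

   Inside a class of vertices with the same h and the same dep, any two vertices
   x, y lie on a cycle of length 2 (u + l), where u is the number of steps after
   which their paths up to the source along a tree meet, and l the same for paths
   down to the sink.  Both u and l are ultrametrics, and u-balls of radius r split
   into at most 3 smaller ones because out-degrees are at most 3.  By the
   four-point condition the pairs at maximal distance u + l cannot occur both
   inside and outside a suitable u-ball, so a class splits into at most 4 parts
   with a smaller maximum.  Hence a class has at most 4^k vertices.

   As there are O(4^k) classes, |G| <= 9 * 16^k, i.e. k >= (log2 |G|)/4 - O(1),
   which suffices since 3 + log2 3 >= 4. *)
Require Import Defs.
From mathcomp Require Import all_boot all_algebra reals exp.
From mathcomp Require Import all_order zify.

Set Implicit Arguments.
Unset Strict Implicit.
Unset Printing Implicit Defensive.

(** * Elimination orders and degrees in critical graphs *)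

Definition out (G : sgraph) (f : G -> nat) (x : G) : {set G} :=
  [set y | adj x y && (f y < f x)].

Lemma degree_induced (G : sgraph) (S : {set G}) (x : induced S) :
  degree x = #|[set y in S | adj (val x) y]|.
Proof.
rewrite /degree -(card_imset _ val_inj); apply: eq_card => y.
rewrite inE; apply/imsetP/andP => [[z xz ->]|[yS xy]].
  by split; [exact: valP | rewrite inE in xz].
by exists (Sub y yS); rewrite ?inE.
Qed.

Lemma low_degree_vertex (G : sgraph) (S : {set G}) :
    degree3_critical G -> S != set0 -> S \proper [set: G] ->
  exists2 x, x \in S & #|[set y in S | adj x y]| <= 2.
Proof.
move=> [_ critG] S0 Sp; have := critG S S0 Sp.
rewrite negb_forall => /existsP[x]; rewrite -ltnNge ltnS degree_induced => x2.
by exists (val x); first exact: valP.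
Qed.

(** A vertex with at most two neighbours in [S] gets the largest value, [#|S| - 1], and the rest of
    [S] is ordered recursively: [f] reverses the order of deletion. *)
Lemma elimination_order (G : sgraph) (S : {set G}) :
    degree3_critical G -> S \proper [set: G] ->
  exists f : G -> nat, [/\ {in S &, injective f}, forall x, x \in S -> f x < #|S|
    & forall x, x \in S -> #|S :&: out f x| <= 2].
Proof.
move=> critG; have [m] := ubnP #|S|; elim: m S => // m IH S Sm Sp.
have [->|S0] := eqVneq S set0.
  by exists (fun=> 0); split=> [x y|x|x]; rewrite inE.
have [x xS x2] := low_degree_vertex critG S0 Sp.
have cS := cardsD1 x S; rewrite xS in cS.
have [|f [finj flt fout]] := IH (S :\ x) _ (sub_proper_trans (subD1set _ _) Sp).
  by rewrite cS in Sm; lia.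
pose g y := if y == x then #|S :\ x| else f y.
have gE y : y != x -> g y = f y by rewrite /g => /negPf->.
have gx : g x = #|S :\ x| by rewrite /g eqxx.
have glt y : y \in S -> y != x -> g y < #|S :\ x|.
  by move=> yS yx; rewrite gE// flt// !inE yx.
exists g; split=> [y z yS zS|y yS|y yS].
- have [->|yx] := eqVneq y x; have [->|zx] := eqVneq z x => //.
  + by rewrite gx => e; have := glt _ zS zx; rewrite -e ltnn.
  + by rewrite gx => e; have := glt _ yS yx; rewrite e ltnn.
  + by rewrite !gE//; apply: finj; rewrite !inE ?yx ?zx.
- have [->|yx] := eqVneq y x; first by rewrite gx; lia.
  by have := glt _ yS yx; lia.
- have [->|yx] := eqVneq y x.
    apply: leq_trans x2; apply: subset_leq_card; apply/subsetP => z.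
    by rewrite !inE => /and3P[-> ->].
  apply: leq_trans (fout y _); last by rewrite !inE yx.
  apply: subset_leq_card; apply/subsetP => z; rewrite !inE => /and3P[zS -> gzy].
  have zx : z != x by apply: contraTneq gzy => ->; rewrite gx -leqNgt ltnW// glt.
  by rewrite zS zx -!gE.
Qed.

Lemma card_edges (G : sgraph) (f : G -> nat) :
  injective f -> #|edges G| = \sum_x #|out f x|.
Proof.
move=> finj; pose D := [set p : G * G | adj p.1 p.2 && (f p.2 < f p.1)].
have -> : edges G = [set [set p.1; p.2] | p in D].
  apply/setP => A; rewrite inE; apply/existsP/imsetP => [[x /existsP[y]]|].
    case/andP=> xy /eqP->; have [yx|yx|/finj e] := ltngtP (f y) (f x).
    - by exists (x, y); rewrite ?inE ?xy.
    - by exists (y, x); rewrite ?inE 1?adj_sym ?xy //= setUC.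
    - by rewrite e adj_irrefl in xy.
  case=> -[x y]; rewrite inE /= => /andP[xy _] ->.
  by exists x; apply/existsP; exists y; rewrite xy eqxx.
rewrite card_in_imset => [|[x y] [x' y']]; last first.
  rewrite !inE /= => /andP[_ yx] /andP[_ yx'] e.
  have := set21 x y; have := set22 x y; rewrite e !inE.
  case/orP=> /eqP ? /orP[] /eqP ?; subst=> //; try by rewrite ltnn in yx.
  by have := ltn_trans yx yx'; rewrite ltnn.
rewrite -sum1_card; under eq_bigl => p do rewrite inE.
rewrite -(pair_big_dep xpredT (fun x y => adj x y && (f y < f x)) (fun _ _ => 1)) /=.
by apply: eq_bigr => x _; rewrite -sum1_card; apply: eq_bigl => y; rewrite inE.
Qed.

Lemma sum_degree (G : sgraph) (f : G -> nat) :
  injective f -> \sum_(x : G) degree x = 2 * #|edges G|.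
Proof.
move=> finj; rewrite (card_edges finj) mul2n -addnn.
rewrite [X in _ = X + _](eq_bigr (fun x => \sum_y (adj x y && (f y < f x) : nat))); last first.
  by move=> x _; rewrite -sum1dep_card big_mkcond; apply: eq_bigr => y _; case: ifP.
rewrite [X in _ = _ + X](eq_bigr (fun x => \sum_y (adj x y && (f y < f x) : nat))); last first.
  by move=> x _; rewrite -sum1dep_card big_mkcond; apply: eq_bigr => y _; case: ifP.
rewrite [X in _ = _ + X]exchange_big /= -big_split /=; apply: eq_bigr => x _.
rewrite -big_split /degree -sum1dep_card big_mkcond /=; apply: eq_bigr => y _.
rewrite [adj y x]adj_sym; case xy : (adj x y) => //=.
have [//|//|/finj e] := ltngtP (f y) (f x).
by rewrite e adj_irrefl in xy.
Qed.

(** The vertices other than [r] form a proper subset and so have an elimination order; [r] is put on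
    top, where all its neighbours are out-neighbours. *)
Lemma root_order (G : sgraph) (r : G) : degree3_critical G ->
  exists f : G -> nat, [/\ injective f, forall x, f x < #|G|, f r = #|G|.-1
    & forall x, x != r -> #|out f x| <= 2].
Proof.
move=> critG; have rp : [set~ r] \proper [set: G].
  by rewrite properT; apply/eqP => /setP/(_ r); rewrite !inE eqxx.
have [f [finj flt fout]] := elimination_order critG rp.
have cG : #|[set~ r]| = #|G|.-1 by rewrite cardsC1.
have G0 : 0 < #|G| by apply/card_gt0P; exists r.
pose g y := if y == r then #|G|.-1 else f y.
have gr : g r = #|G|.-1 by rewrite /g eqxx.
have gE y : y != r -> g y = f y by rewrite /g => /negPf->.
have glt y : y != r -> g y < #|G|.-1 by move=> yr; rewrite gE// -cG flt// !inE.
exists g; split=> // [x y|x|x xr].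
- have [->|xr] := eqVneq x r; have [->|yr] := eqVneq y r => //.
  + by rewrite gr => e; have := glt _ yr; rewrite -e ltnn.
  + by rewrite gr => e; have := glt _ xr; rewrite e ltnn.
  + by rewrite !gE//; apply: finj; rewrite !inE.
- have [->|xr] := eqVneq x r; first by rewrite gr; lia.
  by have := glt _ xr; lia.
- apply: leq_trans (fout x _); last by rewrite !inE.
  apply: subset_leq_card; apply/subsetP => z; rewrite !inE => /andP[-> gzx].
  have zr : z != r by apply: contraTneq gzx => ->; rewrite gr -leqNgt ltnW// glt.
  by rewrite zr -!gE.
Qed.

Lemma card_out_le (G : sgraph) (f : G -> nat) (x : G) :
  injective f -> #|out f x| <= f x.
Proof.
move=> finj; rewrite cardE -(size_map f) -[leqRHS](size_iota 0).
apply: uniq_leq_size; first by rewrite map_inj_uniq ?enum_uniq.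
by move=> _ /mapP[y + ->]; rewrite mem_enum !inE mem_iota => /andP[_].
Qed.

Lemma sum_minn2 (n : nat) : 2 <= n -> \sum_(i < n) minn 2 i + 3 = 2 * n.
Proof.
elim: n => // n IH; rewrite ltnS leq_eqVlt => /predU1P[<-|n2].
  by rewrite !big_ord_recr big_ord0.
by rewrite big_ord_recr /= addnAC IH//; lia.
Qed.

Lemma sum_order (G : sgraph) (f : G -> nat) (F : nat -> nat) :
    injective f -> (forall x, f x < #|G|) ->
  \sum_(x : G) F (f x) = \sum_(i < #|G|) F i.
Proof.
move=> finj flt; pose g x := Ordinal (flt x).
have ginj : injective g by move=> x y /(congr1 val) /finj.
have gbij : bijective g by apply: inj_card_bij; rewrite ?card_ord.
by rewrite (reindex g) //; apply: onW_bij.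
Qed.

Lemma sum_out_rest (G : sgraph) (r : G) (f : G -> nat) :
    2 < #|G| -> injective f -> (forall x, f x < #|G|) -> f r = #|G|.-1 ->
  \sum_(x | x != r) minn 2 (f x) + 5 = 2 * #|G|.
Proof.
move=> G3 finj flt fr; have := sum_minn2 (ltnW G3).
rewrite -(sum_order (minn 2) finj flt) (bigD1 r) //= fr.
by rewrite (_ : minn 2 #|G|.-1 = 2); lia.
Qed.

(** On 2 or 3 vertices there are at most 1 or 3 edges, whereas criticality asks for 2 or 4. *)
Lemma critical_card (G : sgraph) : degree3_critical G -> 1 < #|G| -> 3 < #|G|.
Proof.
move=> critG G1; case: (critG) => eG _.
have /card_gt0P[r _] : 0 < #|G| by exact: ltnW.
have [f [finj flt fr fout]] := root_order r critG.
have out_min x : #|out f x| <= f x by exact: card_out_le.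
have : \sum_x #|out f x| <= \sum_(i < #|G|) i.
  by rewrite -(sum_order id finj flt); apply: leq_sum.
rewrite -(card_edges finj); move: eG G1.
case: #|G| => [|[|[|[|n]]]] //; rewrite !big_ord_recr big_ord0 /=; lia.
Qed.

(** With [x] on top, the other vertices account for at most [0 + 1 + 2 + ... + 2 = 2n - 5] of the
    [2n - 2] edges, so at least three leave [x]. *)
Lemma degree_ge3 (G : sgraph) (x : G) :
  degree3_critical G -> 1 < #|G| -> 2 < degree x.
Proof.
move=> critG G1; have G4 := critical_card critG G1.
have [f [finj flt fx fout]] := root_order x critG.
case: (critG) => eG _; have := sum_out_rest (ltnW G4) finj flt fx.
have := card_edges finj; rewrite (bigD1 x) //=.
have : #|out f x| <= degree x.
  by apply: subset_leq_card; apply/subsetP => y; rewrite !inE => /andP[].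
have : \sum_(y | y != x) #|out f y| <= \sum_(y | y != x) minn 2 (f y).
  by apply: leq_sum => y yx; rewrite leq_min fout// card_out_le.
move: eG; move: (\sum_(y | _) minn 2 _) (\sum_(y | y != x) _) (degree x).
move: #|out f x| #|edges G| #|G| => a b c d e g.
by clear; lia.
Qed.

(** The degrees sum to [4n - 4], so they cannot all be at least 4. *)
Lemma exists_degree3 (G : sgraph) :
  degree3_critical G -> 1 < #|G| -> exists r : G, degree r = 3.
Proof.
move=> critG G1; have /card_gt0P[x0 _] : 0 < #|G| by exact: ltnW.
have [f [finj _ _ _]] := root_order x0 critG; case: (critG) => eG _.
have [/existsP[r /eqP]|/existsPn d3] := boolP [exists r : G, degree r == 3].
  by exists r.
suff : 4 * #|G| <= \sum_(x : G) degree x by rewrite (sum_degree finj); lia.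
rewrite mulnC -sum_nat_const; apply: leq_sum => x _.
by have := degree_ge3 x critG G1; have := d3 x; lia.
Qed.

(* Deleting a vertex of degree 3 leaves a graph with 2m-3 edges on m vertices,
   so every later deletion removes exactly two edges, except for the last two. *)
Lemma degree3_order (G : sgraph) : degree3_critical G -> 1 < #|G| ->
  exists (r : G) (f : G -> nat), [/\ injective f, forall x, f x < #|G|,
    forall x, #|out f x| <= 3, forall x, minn 2 (f x) <= #|out f x|
    & forall x, x != r -> exists y, x \in out f y].
Proof.
move=> critG G1; have G4 := critical_card critG G1.
have [r r3] := exists_degree3 critG G1.
have [f [finj flt fr fout]] := root_order r critG; exists r, f.
have outr : #|out f r| = 3.
  rewrite -r3; apply: eq_card => y; rewrite !inE.
  case ry : (adj r y) => //=; rewrite ltn_neqAle (inj_eq finj).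
  rewrite (contraTneq _ ry) => [|->]; last by rewrite adj_irrefl.
  by rewrite fr -ltnS prednK ?flt // ltnW // ltnW.
have out_le x : x != r -> #|out f x| <= minn 2 (f x).
  by move=> xr; rewrite leq_min fout// card_out_le.
have out_eq x : x != r -> #|out f x| = minn 2 (f x).
  have [_ +] : \sum_(y | y != r) #|out f y| <= \sum_(y | y != r) minn 2 (f y)
      ?= iff [forall (y | y != r), #|out f y| == minn 2 (f y)].
    by apply: leqif_sum => y yr; split=> //; exact: out_le.
  case: (critG) => eG _; have := sum_out_rest (ltnW G4) finj flt fr.
  have := card_edges finj; rewrite (bigD1 r) //= outr => e1 e2 e3.
  have : [forall (y | y != r), #|out f y| == minn 2 (f y)].
    rewrite -e3; move: eG e1 e2; clear.
    move: (\sum_(y | _) minn 2 _) (\sum_(y | _) _) #|edges G| #|G| => a b c d.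
    by lia.
  by move=> /forall_inP e xr; apply/eqP/e.
split=> // [x|x|x xr].
- by have [->|/fout] := eqVneq x r; [rewrite outr | lia].
- by have [->|/out_eq->//] := eqVneq x r; rewrite outr; lia.
(* Out-degree at most 2 and degree at least 3 leave a neighbour with larger [f]. *)
- have : out f x \proper [set y | adj x y].
    rewrite properEcard; apply/andP; split; last first.
      by rewrite (leq_ltn_trans (fout x xr))// degree_ge3.
    by apply/subsetP => y; rewrite !inE => /andP[].
  case/properP=> _ [y]; rewrite !inE => xy; rewrite xy /= -leqNgt => yx.
  exists y; rewrite !inE adj_sym xy ltn_neqAle yx (inj_eq finj) andbT.
  by apply: contraTneq xy => ->; rewrite adj_irrefl.
Qed.

(** * Simple paths and the cycles they close *)

Definition simple_path (G : sgraph) (P : pred G) (x y : G) (k : nat) : Prop :=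
  exists p, [/\ path (@adj G) x p, last x p = y, uniq (x :: p), size p = k
    & all P (x :: p)].

Lemma simple_path_cons (G : sgraph) (P Q : pred G) (x y z : G) (k : nat) :
    adj z x -> ~~ P z -> Q z -> subpred P Q ->
  simple_path P x y k -> simple_path Q z y k.+1.
Proof.
move=> zx Pz Qz PQ [p [xp <- up <- Pp]]; exists (x :: p); split=> //=.
- by rewrite zx.
- by move: up => /= ->; rewrite andbT; apply: contra Pz => /(allP Pp).
- by rewrite Qz; apply: sub_all Pp.
Qed.

Lemma simple_path_sub (G : sgraph) (P Q : pred G) (x y : G) (k : nat) :
  subpred P Q -> simple_path P x y k -> simple_path Q x y k.
Proof.
by move=> PQ [p [xp lp up sp Pp]]; exists p; split=> //; apply: sub_all Pp.
Qed.

Lemma simple_path_sym (G : sgraph) (P : pred G) (x y : G) (k : nat) :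
  simple_path P x y k -> simple_path P y x k.
Proof.
move=> [p [xp <- up <- Pp]]; exists (rev (belast x p)).
have e : last x p :: rev (belast x p) = rev (x :: p) by rewrite [x :: p]lastI rev_rcons.
split; rewrite ?e ?rev_uniq ?all_rev ?size_rev ?size_belast //.
- by rewrite rev_path; apply: sub_path xp => u v; rewrite adj_sym.
- by case: p {xp up Pp e} => //= v p; rewrite rev_cons last_rcons.
Qed.

Lemma mem_cycle_lengths (G : sgraph) (c : seq G) :
  2 < size c -> ucycle (@adj G) c ->
  exists2 i : 'I_(#|G|.+1), i \in cycle_lengths G & i = size c :> nat.
Proof.
move=> c3 /andP[cc uc].
have szc : size c < #|G|.+1 by rewrite ltnS -(card_uniqP uc) max_card.
exists (Ordinal szc) => //; rewrite inE c3 /=.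
by apply/existsP; exists (in_tuple c); rewrite /ucycleb cc.
Qed.

(** [P] and [Q] confine the two paths, so that they meet only in their ends; [2 < k + l] excludes a
    single edge run there and back. *)
Lemma simple_path_cycle (G : sgraph) (P Q : pred G) (x y : G) (k l : nat) :
    (forall z, P z -> Q z -> z = x \/ z = y) -> 2 < k + l ->
    simple_path P x y k -> simple_path Q y x l ->
  x != y -> exists2 i : 'I_(#|G|.+1), i \in cycle_lengths G & i = k + l :> nat.
Proof.
move=> PQ kl [p [xp lp up sp Pp]] [q [yq lq uq sq Qq]] xy.
(* The final [x] of the second path is dropped, as the cycle already starts with it. *)
case/lastP: q yq lq uq sq Qq => [|q x'] yq lq uq sq Qq; first by rewrite -lq eqxx in xy.
move: lq; rewrite last_rcons => e; subst x'.
have <- : size (x :: p ++ q) = k + l by rewrite /= size_cat -sp -sq size_rcons addnS.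
apply: mem_cycle_lengths; first by rewrite /= size_cat -addnS -(size_rcons q x) sp sq.
rewrite /ucycle /= rcons_cat cat_path xp lp yq /= mem_cat negb_or cat_uniq.
move: up uq; rewrite /= rcons_uniq mem_rcons inE negb_or => /andP[xNp ->] /and3P[/andP[_ yNq] xNq ->].
rewrite xNp xNq !andbT /=; apply/hasPn => z zq; apply/negP => zp.
have [] := PQ z _ _.
- by apply: (allP Pp); rewrite inE zp orbT.
- by apply: (allP Qq); rewrite inE mem_rcons inE zq !orbT.
- by move=> e; rewrite -e zq in xNq.
- by move=> e; rewrite -e zq in yNq.
Qed.

(** * Longest paths in an acyclic relation *)

Section Height.
Variables (T : finType) (rank : T -> nat) (s : T -> {set T}).

Fixpoint height_rec (n : nat) (x : T) : nat :=
  if n is n'.+1 then \max_(y in s x) (height_rec n' y).+1 else 0.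

(** Under [rank_lt] the fuel [rank x] suffices, and the value is the length of a longest [s]-path
    from [x]. *)
Definition height (x : T) : nat := height_rec (rank x) x.

(** The first step of a longest path; a point of height 0 is sent to itself by default. *)
Definition descend (x : T) : T :=
  odflt x [pick y in s x | height x == (height y).+1].

Hypothesis rank_lt : forall x y, y \in s x -> rank y < rank x.

Lemma height_recE (n : nat) (x : T) : rank x <= n -> height_rec n x = height x.
Proof.
have [m] := ubnP n; elim: m n x => // m IH [|n] x nm xn.
  by move: xn; rewrite /height leqn0 => /eqP->.
rewrite /height /=; case e : (rank x) => [|d] /=.
  by apply: big1 => y /rank_lt; rewrite e.
apply: eq_bigr => y /rank_lt yx; rewrite !IH //; lia.
Qed.

Lemma height_lt (x y : T) : y \in s x -> height y < height x.
Proof.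
move=> yx; have xy := rank_lt yx; rewrite [height x]/height.
case e : (rank x) => [|d] /=; first by rewrite e in xy.
rewrite -(@height_recE d y); last by rewrite -ltnS -e.
exact: (@bigmax_sup _ y (mem (s x)) _ (fun z => (height_rec d z).+1)) yx (leqnn _).
Qed.

Lemma descendP (x : T) :
  0 < height x -> descend x \in s x /\ height x = (height (descend x)).+1.
Proof.
rewrite /descend => x0; case: pickP => [y /andP[yx /eqP e]//|none].
have [y yx e] : exists2 y, y \in s x & height x = (height y).+1.
  move: x0; rewrite {1 2}/height; case e : (rank x) => [|d] //= x0.
  have [|y yx ey] := eq_bigmax_cond (fun y => (height_rec d y).+1) (A := mem (s x)).
    by rewrite lt0n; apply: contraTneq x0 => /card0_eq s0; rewrite big_pred0.
  exists y; rewrite // -(@height_recE d y); last by rewrite -ltnS -e rank_lt.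
  by rewrite -ey.
by have := none y; rewrite yx e eqxx.
Qed.

Lemma height_descend (x : T) : height (descend x) = (height x).-1.
Proof.
have [x0|/descendP[_ ->]//] := posnP (height x).
rewrite /descend; case: pickP => [y|_ /=]; last by rewrite x0.
by rewrite x0 andbF.
Qed.

(** [descend] lowers the height by exactly one, so it passes through every smaller value. *)
Lemma exists_height (x : T) (j : nat) : j <= height x -> exists y, height y = j.
Proof.
have [m] := ubnP (height x); elim: m x => // m IH x xm.
rewrite leq_eqVlt => /predU1P[->|jx]; first by exists x.
have [|_ e] := @descendP x; first exact: leq_ltn_trans jx.
by apply: (IH (descend x)); lia.
Qed.

End Height.

(** * Merging times as ultrametrics *)

Section Merge.
Variables (T : finType) (g : T -> T) (lev : T -> nat).
Hypothesis lev_g : forall x, lev (g x) = (lev x).-1.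
Hypothesis lev0 : forall x y, lev x = 0 -> lev y = 0 -> x = y.

Lemma lev_gt0 (x y : T) : lev x = lev y -> x != y -> 0 < lev x.
Proof.
by move=> e; rewrite lt0n; apply: contra_neq => x0; apply: lev0; rewrite -?e.
Qed.

Fixpoint merge_rec (n : nat) (x y : T) : nat :=
  if x == y then 0 else if n is n'.+1 then (merge_rec n' (g x) (g y)).+1 else 0.

(** Meant for points of equal [lev]: the fuel [lev x] suffices because at most one point has level
    0. *)
Definition merge_time (x y : T) : nat := merge_rec (lev x) x y.

Lemma mergexx x : merge_time x x = 0.
Proof. by rewrite /merge_time; case: (lev x) => [|n] /=; rewrite eqxx. Qed.

Lemma mergeS (x y : T) :
  lev x = lev y -> x != y -> merge_time x y = (merge_time (g x) (g y)).+1.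
Proof.
move=> e xy; rewrite /merge_time lev_g; have := lev_gt0 e xy.
by case: (lev x) => [|n] //= _; rewrite (negPf xy).
Qed.

Lemma merge_gt0 (x y : T) : lev x = lev y -> x != y -> 0 < merge_time x y.
Proof. by move=> e xy; rewrite mergeS. Qed.

Lemma merge_sym (x y : T) : lev x = lev y -> merge_time x y = merge_time y x.
Proof.
have [m] := ubnP (lev x); elim: m x y => // m IH x y xm e.
have [->//|xy] := eqVneq x y; have x0 := lev_gt0 e xy.
have yx : y != x by rewrite eq_sym.
rewrite (mergeS e xy) (mergeS (esym e) yx) IH // !lev_g ?e //; lia.
Qed.

(** Once [x] has met [y] and [y] has met [z], all three orbits coincide. *)
Lemma merge_ultra (x y z : T) :
  lev x = lev y -> lev y = lev z -> merge_time x z <= maxn (merge_time x y) (merge_time y z).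
Proof.
have [m] := ubnP (lev x); elim: m x y z => // m IH x y z xm exy eyz.
have [->|xz] := eqVneq x z; first by rewrite mergexx.
have [->|xy] := eqVneq x y; first by rewrite leq_maxr.
have [->|yz] := eqVneq y z; first by rewrite leq_maxl.
have x0 := lev_gt0 exy xy.
rewrite (mergeS (etrans exy eyz) xz) (mergeS exy xy) (mergeS eyz yz) maxnSS ltnS.
by apply: IH; rewrite !lev_g ?exy ?eyz//; lia.
Qed.

(** Turns a ball of radius [n] into the set of points with a given [n]-th ancestor. *)
Lemma merge_leE (x y : T) (n : nat) :
  lev x = lev y -> (merge_time x y <= n) = (iter n g x == iter n g y).
Proof.
elim: n x y => [|n IH] x y e /=.
  have [->|xy] := eqVneq x y; first by rewrite mergexx.
  by rewrite mergeS.
have [->|xy] := eqVneq x y; first by rewrite mergexx eqxx.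
by rewrite mergeS// ltnS IH ?lev_g ?e// -!iterSr.
Qed.

End Merge.

(* [Q] is invariant under [g], so that it holds on the inner vertices. *)
Lemma merge_time_path (G : sgraph) (g : G -> G) (lev : G -> nat) (Q : pred G) :
    (forall x, lev (g x) = (lev x).-1) ->
    (forall x y, lev x = 0 -> lev y = 0 -> x = y) ->
    (forall x, 0 < lev x -> adj x (g x)) ->
    (forall x, 0 < lev x -> Q x -> Q (g x)) ->
  forall x y : G, lev x = lev y -> x != y -> Q (g x) -> Q (g y) ->
  simple_path [pred z | (z \in [:: x; y]) || (Q z && (lev z < lev x))] x y
    (2 * merge_time g lev x y).
Proof.
move=> lev_g lev0 adj_g Q_g x y; have [m] := ubnP (lev x).
elim: m x y => // m IH x y xm exy xy Qx Qy.
have x0 := lev_gt0 lev0 exy xy.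
have y0 : 0 < lev y by rewrite -exy.
have gx : lev (g x) < lev x by rewrite lev_g prednK.
have gy : lev (g y) < lev x by rewrite exy lev_g prednK.
pose R := [pred z | Q z && (lev z < lev x)].
suff /(@simple_path_cons _ _ [pred z | (z == x) || R z] _ _ x) : simple_path R (g x) (g y)
    (2 * merge_time g lev (g x) (g y)).
  rewrite (mergeS lev_g lev0 exy xy) mulnS => /(_ (adj_g _ x0)) sp.
  apply: simple_path_sym; apply: (@simple_path_cons _ [pred z | (z == x) || R z]).
  - exact: adj_g.
  - by rewrite /= -exy ltnn andbF orbF eq_sym.
  - by rewrite !inE eqxx orbT.
  - by move=> z /orP[/eqP->|Rz]; rewrite ?inE ?eqxx //=; apply/orP; right.
  - apply: simple_path_sym; apply: sp; rewrite /= ?ltnn ?andbF ?eqxx//.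
    by move=> z /= ->; rewrite orbT.
have [<-|gxy] := eqVneq (g x) (g y).
  by rewrite mergexx; exists [::]; rewrite /= Qx gx.
have eg : lev (g x) = lev (g y) by rewrite !lev_g exy.
have gx0 := lev_gt0 lev0 eg gxy.
apply: simple_path_sub (IH _ _ _ eg gxy _ _).
- move=> z /=; rewrite !inE => /orP[/orP[]/eqP->|/andP[-> zx]].
  + by rewrite Qx gx.
  + by rewrite Qy gy.
  + by rewrite (ltn_trans zx gx).
- by lia.
- exact: Q_g.
- by apply: Q_g; rewrite -?eg.
Qed.

(** * Descending paths, short cycles and the height bound *)

Section Downward.
Variables (G : sgraph) (f : G -> nat).
Hypothesis finj : injective f.
Hypothesis out_min : forall x, minn 2 (f x) <= #|out f x|.

Local Notation h := (height f (out f)).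

Lemma out_lt (x y : G) : y \in out f x -> f y < f x.
Proof. by rewrite inE => /andP[]. Qed.

Lemma out_adj (x y : G) : y \in out f x -> adj x y.
Proof. by rewrite inE => /andP[]. Qed.

Lemma height_gt0 (x : G) : 0 < f x -> 0 < h x.
Proof.
move=> x0; have /card_gt0P[y yx] : 0 < #|out f x| by apply: leq_trans (out_min x); lia.
by apply: leq_ltn_trans (height_lt out_lt yx).
Qed.

(* The path consists of two descending paths; of the two ends, always the
   higher one moves, and to a child that is not the other end. *)
Lemma path_between (x y : G) : x != y ->
  exists2 k, simple_path [pred z | f z <= maxn (f x) (f y)] x y k
    & maxn (h x) (h y) <= k <= h x + h y + 1.
Proof.
have [m] := ubnP (f x + f y); elim: m x y => // m IH x y xym xy.
wlog yx : x y xy xym / f y < f x => [hw|].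
  have := xy; rewrite -(inj_eq finj) neq_ltn => /orP[xy'|]; last exact: hw.
  have [||k /simple_path_sym sp hk] := hw y x _ _ xy'; first by rewrite eq_sym.
    by rewrite addnC.
  by exists k; [rewrite maxnC | lia].
have hx : 0 < h x by apply: height_gt0; lia.
have move_to c : c \in out f x -> c != y -> exists2 k,
    simple_path [pred z | f z <= maxn (f x) (f y)] x y k
    & maxn (h c) (h y) + 1 <= k <= h c + h y + 2.
  move=> cx cy; have cltx := out_lt cx.
  have [|k sp hk] := IH c y _ cy; first by lia.
  exists k.+1; last by lia.
  apply: simple_path_cons sp => /=; [exact: out_adj | lia | lia |].
  by move=> z /=; lia.
have [cx hc] := descendP out_lt hx; set c := descend _ _ x in cx hc.
have [cy|/(move_to c cx)[k sp hk]] := eqVneq c y; last by exists k => //; lia.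
(* Now [h x = h y + 1]. If [f x = 1], the edge from [x] to [y] is the path; otherwise any other
   child [d] gives length at least [h y + 1 = h x]. *)
rewrite cy in cx hc; have [x1|x1] := leqP (f x) 1.
  have y0 : f y = 0 by lia.
  exists 1; last by rewrite hc /height y0.
  exists [:: y]; rewrite /= inE xy (out_adj cx); split=> //.
  by rewrite leq_maxl leq_maxr.
have [d] : exists2 d, d \in out f x & d != y.
  have : 0 < #|out f x :\ y|.
    by have := cardsD1 y (out f x); rewrite cx; have := out_min x; lia.
  by case/card_gt0P=> d; rewrite !inE => /andP[dy dx]; exists d; rewrite ?inE.
move=> dx dy; have [k sp hk] := move_to d dx dy; exists k => //.
by have := height_lt out_lt dx; lia.
Qed.

(** Two out-neighbours [c] and [d] of [z], with [c] on a longest descending path, are joined below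
    [z] by a path of length between [h z - 1] and [2 * h z - 1]; closing it through [z] adds two
    edges. *)
Lemma cycle_at_height (z : G) : 1 < h z ->
  exists2 i : 'I_(#|G|.+1), i \in cycle_lengths G & h z < i <= 2 * h z + 1.
Proof.
move=> hz; have [cz hc] := descendP out_lt (ltnW hz); set c := descend _ _ z in cz hc.
(* This gives [f z >= 2], hence a second out-neighbour of [z]. *)
have c0 : 0 < f c.
  have hc0 : 0 < h c by lia.
  by have [e _] := descendP out_lt hc0; apply: leq_ltn_trans (out_lt e).
have [d dz dc] : exists2 d, d \in out f z & d != c.
  have : 0 < #|out f z :\ c|.
    by have := cardsD1 c (out f z); rewrite cz; have := out_min z; have := out_lt cz; lia.
  by case/card_gt0P=> d; rewrite !inE => /andP[dy dx]; exists d; rewrite ?inE.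
have cd : c != d by rewrite eq_sym.
have [k sp hk] := path_between cd; have hd := height_lt out_lt dz.
have up : simple_path [in [:: d; z; c]] d c 2.
  exists [:: z; c]; rewrite /= !inE !eqxx !orbT (out_adj cz) adj_sym (out_adj dz).
  rewrite negb_or dc; split=> //; rewrite !andbT; apply/andP; split.
    by apply: contraTneq (out_lt dz) => ->; rewrite ltnn.
  by apply: contraTneq (out_lt cz) => ->; rewrite ltnn.
have [w||i iL e] := simple_path_cycle _ _ sp up cd.
- rewrite /= !inE => le /or3P[]/eqP e; [by right | | by left].
  by have := out_lt cz; have := out_lt dz; rewrite e in le; lia.
- by lia.
- by exists i; rewrite // e; lia.
Qed.

(* The intervals [3 * 2 ^ i, 6 * 2 ^ i) each contain a cycle length. *)
Lemma height_bound (z : G) : h z + 2 <= 3 * 2 ^ #|cycle_lengths G|.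
Proof.
rewrite leqNgt; apply/negP => lt; set k := #|_| in lt.
have /fin_all_exists2[g gL gi] : forall i : 'I_k.+1,
    exists2 l : 'I_(#|G|.+1), l \in cycle_lengths G & 3 * 2 ^ i <= l < 3 * 2 ^ i.+1.
  move=> i; have ik : 2 ^ i <= 2 ^ k by rewrite leq_exp2l// -ltnS.
  have [|w hw] := @exists_height _ f (out f) out_lt z (3 * 2 ^ i).-1; first by lia.
  have i0 : 0 < 2 ^ i by rewrite expn_gt0.
  have [|l lL hl] := @cycle_at_height w; first by rewrite hw; lia.
  by exists l; rewrite // expnS; lia.
have ginj : injective g.
  have lt_g (i j : 'I_k.+1) : i < j -> g i < g j.
    move=> ij; have := gi i; have := gi j.
    have : 2 ^ i.+1 <= 2 ^ j by rewrite leq_exp2l.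
    by lia.
  by move=> i j e; have [/lt_g|/lt_g|/val_inj//] := ltngtP i j; rewrite e ltnn.
have : #|codom g| <= k by apply/subset_leq_card/subsetP => l /codomP[i0 ->].
by rewrite (etrans (card_codom ginj) (card_ord _)) ltnn.
Qed.

End Downward.

(** * Counting points under two ultrametrics *)

Lemma card_le_fibers (T I : finType) (c : T -> I) (A : {set T}) (b : nat) :
  (forall i, #|[set x in A | c x == i]| <= b) -> #|A| <= #|I| * b.
Proof.
move=> cb; rewrite -sum1_card (partition_big c xpredT)//= -sum_nat_const.
apply: leq_sum => i _; rewrite sum1dep_card; apply: leq_trans (cb i).
by apply/subset_leq_card/subsetP => x; rewrite !inE.
Qed.

Section TwoUltrametrics.
Variables (T : finType) (S0 : {set T}) (u l : T -> T -> nat).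
Hypothesis uxx : forall x, u x x = 0.
Hypothesis u_gt0 : {in S0 &, forall x y, x != y -> 0 < u x y}.
Hypothesis u_sym : {in S0 &, forall x y, u x y = u y x}.
Hypothesis l_sym : {in S0 &, forall x y, l x y = l y x}.
Hypothesis u_ultra : {in S0 & &, forall x y z, u x z <= maxn (u x y) (u y z)}.
Hypothesis l_ultra : {in S0 & &, forall x y z, l x z <= maxn (l x y) (l y z)}.
Hypothesis u_split : forall x r, x \in S0 -> 0 < r -> exists c : T -> 'I_3,
  {in S0 &, forall y z, u y x <= r -> u z x <= r -> c y = c z -> u y z < r}.

(* If [x, x'] and [y, y'] realise the maximum of [u + l] and some [u]-ball
   contains the first pair but neither [y] nor [y'], then the four-point
   condition gives a cross pair with a larger sum. *)
Lemma maximal_pairs_meet_ball (x x' y y' : T) (m : nat) :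
    x \in S0 -> x' \in S0 -> y \in S0 -> y' \in S0 ->
    u x x' + l x x' = m -> u y y' + l y y' = m ->
    u x x' < u y x -> u x x' < u y' x ->
    u x y + l x y <= m -> u x y' + l x y' <= m ->
    u x' y + l x' y <= m -> u x' y' + l x' y' <= m ->
  False.
Proof.
move=> xS x'S yS y'S; rewrite (u_sym yS xS) (u_sym y'S xS).
have := u_ultra xS x'S yS; have := u_ultra xS x'S y'S.
have := u_ultra yS xS y'S; rewrite (u_sym yS xS).
have := l_ultra xS yS x'S; have := l_ultra xS y'S x'S.
have := l_ultra yS xS y'S; have := l_ultra yS x'S y'S.
rewrite (l_sym yS xS) (l_sym yS x'S) (l_sym y'S x'S).
lia.
Qed.

(** Induction on the list of admissible values: [S] splits into four parts in which the largest
    value attained no longer occurs. [S0] keeps the metric hypotheses fixed while [S] shrinks. *)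
Lemma card_two_ultrametrics (vs : seq nat) (S : {set T}) :
    S \subset S0 ->
    {in S &, forall x y, x != y -> 2 * (u x y + l x y) \in vs} ->
  #|S| <= 4 ^ size vs.
Proof.
have [n] := ubnP (size vs); elim: n vs S => // n IH vs S vsn SS0 Svs.
pose PS := [pred p : T * T | [&& p.1 \in S, p.2 \in S & p.1 != p.2]].
pose D (p : T * T) := u p.1 p.2 + l p.1 p.2.
have [p0 PS0|noPS] := pickP PS; last first.
  apply: leq_trans (_ : 1 <= _); last by rewrite expn_gt0.
  apply/card_le1P => x xS y; rewrite !inE; apply/idP/eqP => [yS|->//].
  by apply/eqP; have := noPS (y, x); rewrite /= xS yS /= => /negbFE.
case: (arg_maxnP D PS0) => p1 PS1 Dmax.
have PS1' : PS p1 && (D p1 == D p1) by rewrite eqxx andbT.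
(* Among the pairs attaining the maximum [m], one with smallest [u] is chosen; this [u] becomes the
   radius of the ball [B]. *)
case: (arg_minnP (P := [pred p | PS p && (D p == D p1)]) (fun p => u p.1 p.2) PS1').
move=> [x x'] /andP[/= /and3P[xS x'S xx'] /eqP Dx] umin.
set m := D p1 in Dmax Dx umin; set r := u x x' in umin.
have Sin z : z \in S -> z \in S0 by move/(subsetP SS0).
have D_le y z : y \in S -> z \in S -> y != z -> u y z + l y z <= m.
  by move=> yS zS yz; apply: (Dmax (y, z)); rewrite /= yS zS.
have vs1 : 2 * m \in vs by rewrite -Dx; apply: Svs.
have size_vs : size vs = (size (rem (2 * m) vs)).+1.
  by rewrite size_rem// prednK//; case: (vs) vs1.
have small (A : {set T}) : A \subset S ->
    {in A &, forall y z, y != z -> u y z + l y z != m} -> #|A| <= 4 ^ (size vs).-1.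
  move=> /subsetP AS Am; rewrite size_vs; apply: IH; first by rewrite -size_vs.
    by apply/subsetP => z /AS/Sin.
  move=> y z yA zA yz; have yzvs := Svs y z (AS _ yA) (AS _ zA) yz.
  have ne : 2 * (u y z + l y z) != 2 * m by rewrite eqn_pmul2l// Am.
  by move: yzvs; rewrite (perm_mem (perm_to_rem vs1)) inE (negPf ne).
have expE : 4 ^ size vs = 3 * 4 ^ (size vs).-1 + 4 ^ (size vs).-1.
  by rewrite size_vs expnS mulSn addnC.
pose B := [set y in S | u y x <= r].
have BS : B \subset S by apply/subsetP => y; rewrite inE => /andP[].
(* Outside [B], a pair with sum [m] would contradict [maximal_pairs_meet_ball]. *)
rewrite -(cardsID B S) expE; apply: leq_add; last first.
  apply: small; first exact: subsetDl.
  have notB z : z \in S :\: B -> z \in S /\ r < u z x.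
    by rewrite !inE => /andP[zB zS]; rewrite zS /= -ltnNge in zB.
  have ne z w : z \in S -> w \in S -> u z x <= r -> r < u w x -> z != w.
    by move=> _ _ zr wr; apply: contraTneq wr => <-; rewrite -leqNgt.
  move=> y y' /notB[yS yr] /notB[y'S y'r] yy'; apply/eqP => Dy.
  have x'r : u x' x <= r by rewrite u_sym ?Sin.
  apply: (@maximal_pairs_meet_ball x x' y y' m); rewrite ?Sin//.
  - by apply: D_le; rewrite // ne// uxx.
  - by apply: D_le; rewrite // ne// uxx.
  - by apply: D_le; rewrite // ne.
  - by apply: D_le; rewrite // ne.
have r0 : 0 < r by apply: u_gt0; rewrite ?Sin.
have [c c_split] := u_split (Sin _ xS) r0.
(* Inside [B], distinct points of one colour have [u < r], so by minimality of [r] their sum is not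
   [m]. *)
rewrite -[X in X * _](card_ord 3); apply: (@card_le_fibers _ _ c) => i.
apply: small => [|y z].
  by apply/subsetP => y; rewrite !inE => /andP[/andP[]].
rewrite !inE => /andP[/and3P[yS _ yr] /eqP cy] /andP[/and3P[zS _ zr] /eqP cz] yz.
apply/eqP => Dyz; have : r <= u y z.
  by apply: (umin (y, z)); rewrite /= yS zS yz -Dyz /D /= eqxx.
by rewrite leqNgt c_split ?Sin// cy cz.
Qed.

End TwoUltrametrics.

(** * The trees towards source and sink *)

Section TwoTrees.
Variables (G : sgraph) (f : G -> nat) (r : G).
Hypothesis finj : injective f.
Hypothesis f_lt : forall x, f x < #|G|.
Hypothesis out_le3 : forall x, #|out f x| <= 3.
Hypothesis out_min : forall x, minn 2 (f x) <= #|out f x|.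
Hypothesis root : forall x, x != r -> exists y, x \in out f y.

Definition inn (x : G) : {set G} := [set y | x \in out f y].

Local Notation h := (height f (out f)).
Local Notation lo := (descend f (out f)).
(** As [f x < #|G|], this rank strictly drops along [inn], so [Height] applies to the reversed
    orientation. *)
Local Notation corank := (fun x => #|G| - f x).
Local Notation dep := (height corank inn).
Local Notation up := (descend corank inn).
Local Notation k := #|cycle_lengths G|.

Lemma inn_lt (x y : G) : y \in inn x -> corank y < corank x.
Proof. by rewrite inE => /out_lt xy; have := f_lt y; have := f_lt x; lia. Qed.

Lemma height0_inj (x y : G) : h x = 0 -> h y = 0 -> x = y.
Proof.
have h0 z : h z = 0 -> f z = 0.
  by have [//|/(height_gt0 out_min)] := posnP (f z); lia.
by move=> /h0 x0 /h0 y0; apply: finj; rewrite x0.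
Qed.

Lemma depth0_inj (x y : G) : dep x = 0 -> dep y = 0 -> x = y.
Proof.
have d0 z : dep z = 0 -> z = r.
  move=> z0; apply/eqP; apply: contraTT isT => /root[w zw].
  by have := height_lt inn_lt (_ : w \in inn z); rewrite z0 inE zw => /(_ isT).
by move=> /d0-> /d0->.
Qed.

(** A step [up] lowers [dep] by one and raises [h] by at least one, so the sum is largest at the
    source, where [height_bound] applies. *)
Lemma depth_height_bound (x : G) : dep x + h x + 2 <= 3 * 2 ^ k.
Proof.
have [m] := ubnP (dep x); elim: m x => // m IH x xm.
have [->|x0] := posnP (dep x); first exact: height_bound.
have [xup e] := descendP inn_lt x0.
have := height_lt (@out_lt _ f) (_ : x \in out f (up x)); rewrite inE in xup.
by move=> /(_ xup) hx; have := IH (up x); lia.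
Qed.

Local Notation u := (merge_time up dep).
Local Notation l := (merge_time lo h).

Lemma up_adj (x : G) : 0 < dep x -> adj x (up x).
Proof. by case/(descendP inn_lt); rewrite inE => /out_adj; rewrite adj_sym. Qed.

Lemma lo_adj (x : G) : 0 < h x -> adj x (lo x).
Proof. by case/(descendP (@out_lt _ f)) => /out_adj. Qed.

Lemma height_up (x : G) : 0 < dep x -> h x < h (up x).
Proof. by case/(descendP inn_lt); rewrite inE => /(height_lt (@out_lt _ f)). Qed.

Lemma height_lo (x : G) : 0 < h x -> h (lo x) < h x.
Proof. by case/(descendP (@out_lt _ f)) => /(height_lt (@out_lt _ f)). Qed.

(** Apart from its ends, the path through the [up] tree stays above height [h x] and the one through
    the [lo] tree below it, so they share only [x] and [y]. *)
Lemma two_tree_cycle (x y : G) : h x = h y -> dep x = dep y -> x != y ->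
  2 * (u x y + l x y) \in [seq val i | i <- enum (cycle_lengths G)].
Proof.
move=> hxy dxy xy.
have hx := lev_gt0 height0_inj hxy xy; have dx := lev_gt0 depth0_inj dxy xy.
have l0 := merge_gt0 (height_descend (@out_lt _ f)) height0_inj hxy xy.
have u0 := merge_gt0 (height_descend inn_lt) depth0_inj dxy xy.
have upper : simple_path
    [pred z | (z \in [:: x; y]) || ((h x < h z) && (dep z < dep x))] x y (2 * u x y).
  apply: (@merge_time_path G up dep [pred z | h x < h z]) => //=.
  - exact: height_descend inn_lt.
  - exact: depth0_inj.
  - exact: up_adj.
  - by move=> z z0 xz; apply: ltn_trans xz _; apply: height_up.
  - exact: height_up.
  - by rewrite hxy height_up// -dxy.
(* Here [h] is both level and invariant, hence the repeated condition. *)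
have lower : simple_path
    [pred z | (z \in [:: x; y]) || ((h z < h x) && (h z < h x))] x y (2 * l x y).
  apply: (@merge_time_path G lo h [pred z | h z < h x]) => //=.
  - exact: height_descend (@out_lt _ f).
  - exact: height0_inj.
  - exact: lo_adj.
  - by move=> z z0 zx; apply: ltn_trans zx; apply: height_lo.
  - exact: height_lo.
  - by rewrite hxy height_lo// -hxy.
have [||i iL e] := simple_path_cycle _ _ upper (simple_path_sym lower) xy.
- move=> z /=; rewrite !inE => /orP[/orP[]/eqP->|/andP[xz _]]; [by left|by right|].
  case/orP=> [/orP[]/eqP->|/andP[zx _]]; [by left|by right|].
  by have := ltn_trans xz zx; rewrite ltnn.
- by lia.
by apply/mapP; exists i; rewrite ?mem_enum // mulnDr -e.
Qed.

(** Points of the ball share their [n]-th ancestor; [c] records which of its at most three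
    out-neighbours is the ancestor one step earlier. *)
Lemma merge_up_split (x : G) (n : nat) : 0 < n -> exists c : G -> 'I_3,
  forall y z, dep y = dep x -> dep z = dep x -> u y x <= n -> u z x <= n ->
  c y = c z -> u y z < n.
Proof.
case: n => // n _; have lev_up := height_descend inn_lt.
pose a := iter n.+1 up x; pose b y := iter n up y.
exists (fun y => inord (index (b y) (enum (out f a)))) => y z yx zx.
rewrite !(merge_leE lev_up depth0_inj) // => /eqP ya /eqP za e.
rewrite ltnS (merge_leE lev_up depth0_inj) ?yx ?zx //; apply/eqP.
have dep_b w : dep (b w) = dep w - n.
  by rewrite /b; elim: (n) => [|m IH]; rewrite ?subn0//= lev_up IH subnS.
(* At depth 0 there is no parent to speak of, but then [b y] and [b z] are both the source. *)
have [bz|bz] := posnP (dep (b z)).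
  by apply: depth0_inj; rewrite -/(b _) ?dep_b ?yx -?zx -?dep_b bz.
have by_a w : up (b w) = a -> 0 < dep (b w) -> b w \in enum (out f a).
  by move=> <- /(descendP inn_lt)[]; rewrite mem_enum inE.
have yb : b y \in enum (out f a).
  by apply: by_a; rewrite // dep_b yx -zx -dep_b.
have zb : b z \in enum (out f a) by apply: by_a.
(* Indices in [out f a] are below 3 by [out_le3], so [inord] loses nothing. *)
move/(congr1 val): e; rewrite /= !inordK; first 1 last.
- by rewrite (leq_trans _ (out_le3 a))// cardE index_mem.
- by rewrite (leq_trans _ (out_le3 a))// cardE index_mem.
by move/(congr1 (nth y (enum (out f a)))); rewrite !nth_index.
Qed.

Lemma card_level_class (i j : nat) : #|[set x | (h x == i) && (dep x == j)]| <= 4 ^ k.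
Proof.
set S := [set x | _]; have lev_up := height_descend inn_lt.
have lev_lo := height_descend (@out_lt _ f).
have hS : {in S &, forall x y, h x = h y}.
  by move=> x y; rewrite !inE => /andP[/eqP-> _] /andP[/eqP-> _].
have dS : {in S &, forall x y, dep x = dep y}.
  by move=> x y; rewrite !inE => /andP[_ /eqP->] /andP[_ /eqP->].
rewrite [#|cycle_lengths G|]cardE -(size_map val); apply: (@card_two_ultrametrics _ S u l) => //.
- by move=> x; rewrite mergexx.
- by move=> x y xS yS; apply: (merge_gt0 lev_up depth0_inj); rewrite (dS x y).
- by move=> x y xS yS; apply: (merge_sym lev_up depth0_inj); rewrite (dS x y).
- by move=> x y xS yS; apply: (merge_sym lev_lo height0_inj); rewrite (hS x y).
- move=> x y z xS yS zS; apply: (merge_ultra lev_up depth0_inj); exact: dS.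
- move=> x y z xS yS zS; apply: (merge_ultra lev_lo height0_inj); exact: hS.
- move=> x n xS /(merge_up_split x)[c c_split]; exists c => y z yS zS.
  by apply: c_split; apply: dS.
- by move=> x y xS yS; apply: two_tree_cycle; [apply: hS | apply: dS].
Qed.

(** Both [h] and [dep] are below [m = 3 * 2 ^ k], which makes [m ^ 2 = 9 * 4 ^ k] classes of at most
    [4 ^ k] vertices each. *)
Lemma card_bound : #|G| <= 9 * 16 ^ k.
Proof.
pose m := 3 * 2 ^ k; have m0 : 0 < m by rewrite muln_gt0 expn_gt0.
pose c (x : G) : 'I_m.-1.+1 * 'I_m.-1.+1 := (inord (h x), inord (dep x)).
have hm x : h x < m.-1.+1 by have := depth_height_bound x; rewrite prednK// -/m; lia.
have dm x : dep x < m.-1.+1 by have := depth_height_bound x; rewrite prednK// -/m; lia.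
have : #|[set: G]| <= #|{: 'I_m.-1.+1 * 'I_m.-1.+1}| * 4 ^ k.
  apply: (@card_le_fibers _ _ c) => -[i j]; apply: leq_trans (card_level_class i j).
  apply/subset_leq_card/subsetP => x; rewrite !inE /= => /eqP[<- <-].
  by rewrite !inordK// !eqxx.
rewrite cardsT card_prod card_ord prednK// /m => /leq_trans; apply.
by rewrite (_ : 16 = 2 * 2 * 4)// !expnMn; lia.
Qed.

End TwoTrees.

Lemma critical_card_bound (G : sgraph) :
  degree3_critical G -> #|G| <= 9 * 16 ^ #|cycle_lengths G|.
Proof.
move=> critG; have [G1|G1] := leqP #|G| 1.
  by apply: leq_trans G1 _; rewrite muln_gt0 expn_gt0.
have [r [f [finj flt out3 outmin root]]] := degree3_order critG G1.
exact: (card_bound finj flt out3 outmin root).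
Qed.

(** * Passage to logarithms *)

Unset Implicit Arguments.
Import Order.TTheory GRing.Theory Num.Theory.

Local Open Scope ring_scope.

Lemma log2_critical_card (R : realType) (G : sgraph) : degree3_critical G ->
  0 <= log2 (#|G|%:R : R) <= log2 (9 : R) + 4 * #|cycle_lengths G|%:R.
Proof.
move=> critG; have n_le := critical_card_bound critG.
(* The edge count [#|edges G| + 2 = 2 * #|G|] excludes the graph without vertices. *)
have n0 : (0 < #|G|)%N by case: critG => [+ _]; lia.
have ln2 : 0 < ln (2 : R) by rewrite ln_gt0// ltr1n.
have -> : log2 (9 : R) + 4 * #|cycle_lengths G|%:R =
    ln ((9 * 16 ^ #|cycle_lengths G|)%N%:R : R) / ln 2.
  have ln16 : ln (16 : R) = 4 * ln 2.
    by rewrite (_ : 16 = 2 ^+ 4 :> R) ?lnXn// -?natrX// mulr_natl.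
  rewrite natrM natrX lnM ?posrE ?exprn_gt0 ?ltr0n// lnXn ?ltr0n// ln16.
  rewrite -(mulr_natr (4 * ln 2)) [RHS]mulrDl; congr (_ + _).
  by rewrite [RHS]mulrAC mulfK ?gt_eqF.
apply/andP; split; first by rewrite divr_ge0 ?ln_ge0 ?ler1n// ltW.
rewrite /log2 ler_pM2r ?invr_gt0//.
by rewrite ler_ln ?posrE ?ltr0n ?ler_nat// (leq_trans n0).
Qed.

Theorem theorem1p2 (R : realType) :
  exists C : R, forall G : sgraph, degree3_critical G ->
    log2 (#|G|%:R : R) / (3 + log2 (3 : R)) - C <= #|cycle_lengths G|%:R.
Proof.
(* [log2 9] absorbs the factor 9 of [critical_card_bound]. *)
exists (log2 9) => G /(log2_critical_card R)/andP[n0 n_le].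
have ln2 : 0 < ln (2 : R) by rewrite ln_gt0// ltr1n.
have log3 : 1 <= log2 (3 : R).
  by rewrite /log2 ler_pdivlMr// mul1r ler_ln ?posrE ?ltr0n ?ler_nat.
have log9 : 0 <= log2 (9 : R).
  by rewrite divr_ge0 ?ln_ge0 ?ler1n// ltW.
have d4 : 4 <= 3 + log2 (3 : R) by rewrite -(lerD2l 3) in log3; rewrite (le_trans _ log3)// -natr1.
rewrite lerBlDr ler_pdivrMr ?(lt_le_trans _ d4)//.
(* With [k] the number of lengths, [log2 9 + 4 k <= 4 (k + log2 9) <= (3 + log2 3) (k + log2 9)]. *)
apply: le_trans n_le (le_trans _ (ler_wpM2l _ d4)); last by rewrite addr_ge0.
by rewrite [(_ + _) * 4]mulrDl [leRHS]addrC [4 * _]mulrC lerD2r ler_peMr// ler1n.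
Qed.
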